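(* Let $X$ be a Baire space, let $Y$ be a topological space with at most countable $\pi$-character, and let $Z$ be a topological space in which every two distinct points can be separated by closed neighborhoods, i.e. for all $z_1\neq z_2$ in $Z$ there are closed neighborhoods $F_1$ of $z_1$ and $F_2$ of $z_2$ with $F_1\cap F_2=\emptyset$. Then every separately continuous function $f:X\times Y\to Z$ is totally determined by its values on any dense subset of $X\times Y$: if $A\subseteq X\times Y$ is dense in $X\times Y$ with respect to the product topology, and $f,g:X\times Y\to Z$ are separately continuous functions with $f|_A=g|_A$, then $f=g$.
   Context: A function $f:X\times Y\to Z$ is separately continuous if for every $x\in X$ the map $y\mapsto f(x,y)$ is continuous on $Y$ and for every $y\in Y$ the map $x\mapsto f(x,y)$ is continuous on $X$. For a topological space $Y$ and $y\in Y$, the $\pi$-character $\pi_\chi(y,Y)$ of $Y$ at $y$ is the minimal cardinality of a family $\mathcal U$ of nonempty open subsets of $Y$ such that for every neighborhood $V$ of $y$ there exists $U\in\mathcal U$ with $U\subseteq V$. The $\pi$-character of $Y$ is $\pi_\chi(Y)=\sup_{y\in Y}\pi_\chi(y,Y)$. A Baire space is a topological space in which the intersection of every countable family of dense open sets is dense. *)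

(* Defs.v *)
From mathcomp Require Import all_boot all_order all_classical topology.

Set Implicit Arguments.
Unset Strict Implicit.
Unset Printing Implicit Defensive.

Local Open Scope classical_set_scope.

Definition separately_continuous (X Y Z : topologicalType) (f : X * Y -> Z) :=
  (forall x : X, continuous (fun y : Y => f (x, y))) /\
  (forall y : Y, continuous (fun x : X => f (x, y))).

Definition baire_space (X : topologicalType) :=
  forall F : set (set X), countable F ->
    (forall U, F U -> open U /\ dense U) -> dense (\bigcap_(U in F) U).

Definition local_pi_base (Y : topologicalType) (y : Y) (B : set (set Y)) :=
  (forall U, B U -> open U /\ U !=set0) /\
  (forall V, nbhs y V -> exists2 U, B U & U `<=` V).

(* There is no type of cardinal numbers: pi_chi(y, Y) is represented by the
   families B that attain the minimum, so that pi_chi(y, Y) = |B|. *)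
Definition attains_pi_character (Y : topologicalType) (y : Y)
    (B : set (set Y)) :=
  local_pi_base y B /\ forall C, local_pi_base y C -> (B #<= C)%card.

(* The supremum pi_chi(Y) is at most aleph_0 iff aleph_0 is an upper bound of
   all the pi_chi(y, Y). *)
Definition countable_pi_character (Y : topologicalType) :=
  forall y : Y, exists2 B, attains_pi_character y B & countable B.

(* Requiring the minimum to be attained costs nothing: a countable local
   pi-base always yields one of minimal cardinality. *)
Lemma countable_pi_characterP (Y : topologicalType) :
  countable_pi_character Y <->
  forall y : Y, exists2 B, local_pi_base y B & countable B.
Proof.
split=> [H y|H y]; first by have [B [? _] ?] := H y; exists B.
have [B Bb Bc] := H y.
have [[n [C Cb Cn]]|nofin] :=
    pselect (exists n, exists2 C, local_pi_base y C & (C #= `I_n)%card); last first.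
  exists B => //; split=> // C Cb.
  apply: (card_le_trans Bc); apply/infiniteP => /finite_setP[n Cn].
  by apply: nofin; exists n, C.
have ex : exists n, `[< exists2 C, local_pi_base y C & (C #= `I_n)%card >].
  by exists n; apply/asboolP; exists C.
case: (ex_minnP ex) => m /asboolP[D Db Dm] mmin.
exists D; last by apply: finite_set_countable; apply/finite_setP; exists m.
split=> // E Eb.
have [/finite_setP[k Ek]|/infiniteP nE] := pselect (finite_set E); last first.
  apply: card_le_trans nE.
  by apply: finite_set_countable; apply/finite_setP; exists m.
rewrite (card_le_eql Dm) (card_le_eqr Ek) card_le_II.
by apply: mmin; apply/asboolP; exists E.
Qed.

Definition separated_by_closed_nbhs (Z : topologicalType) :=
  forall z1 z2 : Z, z1 <> z2 ->
    exists F1 F2 : set Z,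
      [/\ closed F1, nbhs z1 F1, closed F2, nbhs z2 F2 & F1 `&` F2 = set0].

(* Main.v *)
Require Import Defs.
From mathcomp Require Import all_boot all_order all_classical topology.

Local Open Scope classical_set_scope.

(** If [f] and [g] differ at [(x0, y0)], separate their values there by disjoint
    closed neighborhoods [F] and [G].  For [x] near [x0], some member [V] of a
    countable local pi-base at [y0] has [f(x, V)] in [F] and [g(x, V)] in [G].
    The set of all [x] good for a given [V] is closed, so by the Baire property
    one of them contains a nonempty open [W].  Then [f] and [g] differ
    everywhere on [W * V], which must meet the dense set [A]. *)

Lemma closed_forall_preimage (X Y Z : topologicalType) (f : X * Y -> Z)
    (V : set Y) (F : set Z) :
  (forall y, continuous (fun x => f (x, y))) -> closed F ->
  closed [set x | forall y, V y -> F (f (x, y))].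
Proof.
move=> fc Fc.
rewrite (_ : [set x | _] = \bigcap_(y in V) ((fun x => f (x, y)) @^-1` F)) //.
by apply: closed_bigI => y _; apply: preimage_closed => // x _; exact: fc.
Qed.

(** Otherwise the complements of the [C i] are open and dense, so by the Baire property their
    countable intersection meets [U], at a point that no [C i] covers. *)
Lemma baire_countable_closed_cover (X : topologicalType) (I : Type)
    (D : set I) (C : I -> set X) (U : set X) :
  baire_space X -> countable D -> (forall i, D i -> closed (C i)) ->
  open U -> U !=set0 -> U `<=` \bigcup_(i in D) C i ->
  exists2 i, D i & exists W, [/\ open W, W !=set0 & W `<=` C i].
Proof.
move=> hX Dc Cc Uo U0 UC; apply: contrapT => nW.
have cC : countable [set ~` C i | i in D].
  exact: card_le_trans (card_image_le _ _) Dc.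
have dC S : [set ~` C i | i in D] S -> open S /\ dense S.
  move=> [i Di <-]; split; first by rewrite openC; exact: Cc.
  move=> W W0 Wo; apply: contrapT => WC; apply: nW; exists i => //.
  exists W; split=> // x Wx; apply: contrapT => nCx.
  by apply: WC; exists x.
have [x [Ux Cx]] := hX _ cC dC U U0 Uo.
have [i Di Cix] := UC _ Ux.
by apply: (Cx (~` C i)) => //; exists i.
Qed.

Theorem theorem3p2 (X Y Z : topologicalType)
    (hX : baire_space X) (hY : countable_pi_character Y)
    (hZ : separated_by_closed_nbhs Z)
    (A : set (X * Y)) (hA : dense A) (f g : X * Y -> Z)
    (hf : separately_continuous f) (hg : separately_continuous g)
    (hfg : forall p, A p -> f p = g p) :
  f = g.
Proof.
move: hf hg => [fY fX] [gY gX].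
apply/funext => -[x0 y0]; apply: contrapT => /hZ [F [G [Fc Fn Gc Gn FG0]]].
have [B [[Bo Bsub] _] Bc] := hY y0.
pose C V := [set x | forall y, V y -> F (f (x, y))] `&`
            [set x | forall y, V y -> G (g (x, y))].
(* Interiors make [U] open; it contains [x0] since [F] and [G] are neighborhoods of the values at
   [(x0, y0)]. *)
pose U := ((fun x => f (x, y0)) @^-1` F°) `&` ((fun x => g (x, y0)) @^-1` G°).
have [||||||V BV [W [Wo W0 WC]]] := @baire_countable_closed_cover X _ B C U.
- exact: hX.
- exact: Bc.
- move=> V _; apply: closedI.
    exact: (closed_forall_preimage X Y Z f V F fX Fc).
  exact: (closed_forall_preimage X Y Z g V G gX Gc).
- apply: openI; apply: open_comp; try exact: open_interior.
    by move=> x _; exact: fX.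
  by move=> x _; exact: gX.
- by exists x0.
- move=> x [Fx Gx].
  (* With [x] fixed, continuity in [y] at [y0] applies, as [F] and [G] are neighborhoods of the
     values at [(x, y0)]. *)
  have FGn : nbhs y0 ([set y | F (f (x, y))] `&` [set y | G (g (x, y))]).
    by apply: filterI; [exact: (fY x y0 F Fx) | exact: (gY x y0 G Gx)].
  have [V BV VFG] := Bsub _ FGn.
  by exists V => //; split=> y /VFG [].
have [Vo [y Vy]] := Bo V BV; have [x Wx] := W0.
have [||[a b] [[/= Wa Vb] /hfg fgab]] := hA (W `*` V).
- by exists (x, y).
- rewrite openE => -[a b] [/= Wa Vb].
  by exists (W, V) => //; split; exact: open_nbhs_nbhs.
have [/(_ b Vb) Fab /(_ b Vb) Gab] := WC a Wa.
(* As [(a, b)] lies in [A], the common value of [f] and [g] there lies in both disjoint sets. *)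
suff : (F `&` G) (f (a, b)) by rewrite FG0.
by split=> //; rewrite fgab.
Qed.
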